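(* Let $P=P(A,a)=\{x\in\mathbb{R}^d:Ax\le a\}$ be a $d$-polytope and $Q=P(B,b)=\{y\in\mathbb{R}^e: By\le b\}$ a simple $e$-polytope, with $A\in\mathbb{R}^{k\times d}$ and $B\in\mathbb{R}^{n\times e}$, let $C\in\mathbb{R}^{n\times d}$ be an arbitrary matrix, let $P\bowtie_C Q$ be the deformed product of $P$ and $Q$ with respect to $C$, and let $M>0$ be the parameter involved in its construction. If $M$ is sufficiently large (depending on $B$, $b$ and $C$), then $P\bowtie_C Q$ and $P\times Q$ are combinatorially equivalent.
   Context: The systems $Ax\le a$ and $By\le b$ are irredundant: discarding any one of the inequalities changes the polytope. A polytope is simple if every nonempty face $F$ is contained in exactly (dimension of the polytope) $-\dim F$ facets. Two polytopes are combinatorially equivalent if their face lattices are isomorphic. For a parameter $M>0$, the deformed product of $P$ and $Q$ with respect to $C$ (called a rank $r$ deformed product if $C$ has rank $r$) is $$P\bowtie_C Q=\{(x,y)\in\mathbb{R}^{d+e}: Ax\le a,\ Cx+By\le M\,b\}.$$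
   Formalization: The threshold for M is allowed to depend on B, b, C and also on a bound rho for the coordinates of points of P, since a threshold depending only on B, b and C fails (P=[-t,t], Q=[0,1], deformed product a triangle for M ≤ t). *)

(* Defs.v *)
From HB Require Import structures.
From mathcomp Require Import all_boot all_order all_algebra.
From mathcomp Require Import boolp classical_sets functions cardinality reals.

Set Implicit Arguments.
Unset Strict Implicit.
Unset Printing Implicit Defensive.

Import Order.TTheory GRing.Theory Num.Theory.

Local Open Scope classical_set_scope.
Local Open Scope ring_scope.

Definition cvle (R : realType) (k : nat) (u v : 'cV[R]_k) : Prop :=
  forall i, u i 0 <= v i 0.

Definition polyhedron (R : realType) (k d : nat) (A : 'M[R]_(k, d))
    (a : 'cV[R]_k) : set 'cV[R]_d :=
  [set x | cvle (A *m x) a].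

Definition irredundant (R : realType) (k d : nat) (A : 'M[R]_(k, d))
    (a : 'cV[R]_k) : Prop :=
  forall i : 'I_k, polyhedron (row' i A) (row' i a) <> polyhedron A a.

Definition in_box (R : realType) (d : nat) (rho : R) (S : set 'cV[R]_d) : Prop :=
  forall x, S x -> forall i, `|x i 0| <= rho.

Definition affine_subspace (R : realType) (d : nat) (x0 : 'cV[R]_d)
    (V : {vspace 'cV[R]_d}) : set 'cV[R]_d :=
  [set x | x - x0 \in V].

(* [S] is nonempty and its affine hull [x0 + V] has dimension [m]; the empty
   set has no dimension in this sense. *)
Definition has_dim (R : realType) (d : nat) (S : set 'cV[R]_d) (m : nat) : Prop :=
  exists (x0 : 'cV[R]_d) (V : {vspace 'cV[R]_d}),
    [/\ S x0, S `<=` affine_subspace x0 V,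
        forall x1 W, S `<=` affine_subspace x1 W ->
          affine_subspace x0 V `<=` affine_subspace x1 W
      & \dim V = m].

Definition polytope (R : realType) (d : nat) (S : set 'cV[R]_d) : Prop :=
  (exists (k : nat) (A : 'M[R]_(k, d)) (a : 'cV[R]_k), S = polyhedron A a) /\
  (exists rho : R, in_box rho S).

Definition polytope_of_dim (R : realType) (d D : nat) (S : set 'cV[R]_d) : Prop :=
  polytope S /\ has_dim S D.

(* [c = 0] is allowed, so that [S] and the empty set are faces of [S]. *)
Definition is_face (R : realType) (d : nat) (S F : set 'cV[R]_d) : Prop :=
  exists (c : 'rV[R]_d) (c0 : R),
    (forall x, S x -> (c *m x) 0 0 <= c0) /\
    F = S `&` [set x | (c *m x) 0 0 = c0].

Definition faces (R : realType) (d : nat) (S : set 'cV[R]_d) :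
    set (set 'cV[R]_d) :=
  [set F | is_face S F].

(* The empty facet of a 0-dimensional polytope is left out; it contains no
   nonempty face, so simplicity does not see it. *)
Definition is_facet (R : realType) (d : nat) (S G : set 'cV[R]_d) : Prop :=
  is_face S G /\ exists m : nat, has_dim S m.+1 /\ has_dim G m.

Definition simple_polytope (R : realType) (d : nat) (S : set 'cV[R]_d) : Prop :=
  polytope S /\
  forall (F : set 'cV[R]_d) (D m : nat),
    is_face S F -> F !=set0 -> has_dim S D -> has_dim F m ->
    ([set G | is_facet S G /\ F `<=` G] #= `I_(D - m)%N)%card.

(* An isomorphism of the face lattices, ordered by inclusion. *)
Definition combinatorially_equivalent (R : realType) (d1 d2 : nat)
    (S : set 'cV[R]_d1) (T : set 'cV[R]_d2) : Prop :=
  exists f : set 'cV[R]_d1 -> set 'cV[R]_d2,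
    set_bij (faces S) (faces T) f /\
    forall F G, faces S F -> faces S G -> (F `<=` G <-> f F `<=` f G).

(* A point (x, y) of R^d x R^e is the column vector [col_mx x y]. *)
Definition cartesian (R : realType) (d e : nat) (S : set 'cV[R]_d)
    (T : set 'cV[R]_e) : set 'cV[R]_(d + e) :=
  [set z | S (usubmx z) /\ T (dsubmx z)].

Definition deformed_product (R : realType) (k n d e : nat)
    (A : 'M[R]_(k, d)) (a : 'cV[R]_k) (B : 'M[R]_(n, e)) (b : 'cV[R]_n)
    (C : 'M[R]_(n, d)) (M : R) : set 'cV[R]_(d + e) :=
  [set z | cvle (A *m usubmx z) a /\
           cvle (C *m usubmx z + B *m dsubmx z) (M *: b)].

(* Main.v *)
(* Nonempty faces of a polyhedron correspond to the sets of inequalities that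
   are exactly the tight ones at some point, so two polyhedra given by equally
   many inequalities are combinatorially equivalent as soon as the same sets of
   inequalities are tight in both. Substituting y = M y', the fibre of the
   deformed product over x is { y' : B y' <= b - M^-1 C x }, a small
   perturbation of Q when M is large, uniformly for x in the box. Because Q is
   simple, the rows of B tight at a point of Q are linearly independent; hence
   every tight set of Q survives a small perturbation of b. Conversely a set of
   inequalities not simultaneously tight on Q stays away from tightness by
   compactness, and by linear independence the sets that can be tight on Q are
   closed under taking subsets. *)
Require Import Defs.
From HB Require Import structures.
From mathcomp Require Import all_boot all_order all_algebra.
From mathcomp Require Import boolp classical_sets functions cardinality reals.
From mathcomp Require Import topology normedtype derive.
From mathcomp Require Import ring lra.

Set Implicit Arguments.
Unset Strict Implicit.
Unset Printing Implicit Defensive.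

Import Order.TTheory GRing.Theory Num.Theory.
Import numFieldNormedType.Exports.

Local Open Scope classical_set_scope.
Local Open Scope ring_scope.

(** * Preliminaries: uniform thresholds and evaluation of rows *)

(** [P t] passes to smaller positive thresholds, so the minimum of the finitely many thresholds
    serves every [t]. *)
Lemma uniform_small (R : realType) (T : finType) (P : T -> R -> Prop) :
  (forall t eps del, 0 < eps -> eps <= del -> P t del -> P t eps) ->
  (forall t, exists2 del, 0 < del & P t del) ->
  exists2 del, 0 < del & forall t, P t del.
Proof.
move=> Pdown exP.
suff [del del0 Pdel] : exists2 del, 0 < del & forall t, t \in enum T -> P t del.
  by exists del => // t; apply: Pdel; rewrite mem_enum.
elim: (enum T) => [|t s [del del0 Pdel]]; first by exists 1.
have [eps eps0 Peps] := exP t.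
exists (Num.min del eps) => [|u]; first by rewrite lt_min del0 eps0.
rewrite inE => /predU1P[->|/Pdel].
  by apply: Pdown Peps; rewrite ?lt_min ?del0 ?eps0 // ge_min lexx orbT.
by apply: Pdown; rewrite ?lt_min ?del0 ?eps0 // ge_min lexx.
Qed.

Lemma mulmx_ray (R : realType) (k d : nat) (A : 'M[R]_(k, d))
    (x v : 'cV[R]_d) (t : R) i :
  (A *m (x + t *: v)) i 0 = (A *m x) i 0 + t * (A *m v) i 0.
Proof. by rewrite mulmxDr -scalemxAr !mxE. Qed.

Lemma mulmx_subE (R : realType) (k d : nat) (A : 'M[R]_(k, d))
    (x y : 'cV[R]_d) i :
  (A *m (x - y)) i 0 = (A *m x) i 0 - (A *m y) i 0.
Proof. by rewrite -scaleN1r mulmx_ray mulN1r. Qed.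

Lemma mulmx_midE (R : realType) (k d : nat) (A : 'M[R]_(k, d))
    (x y : 'cV[R]_d) i :
  (A *m (2^-1 *: (x + y))) i 0 = ((A *m x) i 0 + (A *m y) i 0) / 2.
Proof. by rewrite -scalemxAr mulmxDr !mxE mulrC. Qed.

Lemma sum_row_mulmx (R : realType) (k d : nat) (A : 'M[R]_(k, d))
    (J : {set 'I_k}) (x : 'cV[R]_d) :
  ((\sum_(i in J) row i A) *m x) 0 0 = \sum_(i in J) (A *m x) i 0.
Proof.
rewrite mulmx_suml summxE; apply: eq_bigr => i _.
by rewrite -row_mul mxE.
Qed.

(** * Tight sets and the faces they define *)

Definition tight (R : realType) (k d : nat) (A : 'M[R]_(k, d))
    (a : 'cV[R]_k) (x : 'cV[R]_d) : {set 'I_k} :=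
  [set i | (A *m x) i 0 == a i 0]%SET.

Section Polyhedron.
Variables (R : realType) (k d : nat) (A : 'M[R]_(k, d)) (a : 'cV[R]_k).
Implicit Types (x y v : 'cV[R]_d) (i : 'I_k) (J : {set 'I_k}) (F : set 'cV[R]_d).
Local Notation S := (polyhedron A a).

Lemma tightP x i : reflect ((A *m x) i 0 = a i 0) (i \in tight A a x).
Proof. by rewrite inE; apply: eqP. Qed.

Lemma slack_gt0 x i : S x -> i \notin tight A a x -> (A *m x) i 0 < a i 0.
Proof. by move=> Sx; rewrite inE lt_neqAle Sx andbT. Qed.

(** Rows tight at [x] do not increase along [v], and each of the others has a positive slack that a
    short step cannot use up. *)
Lemma small_step x v :
  S x -> (forall i, i \in tight A a x -> (A *m v) i 0 <= 0) ->
  exists2 t, 0 < t & forall i, (A *m (x + t *: v)) i 0 <= a i 0 /\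
    (i \notin tight A a x -> (A *m (x + t *: v)) i 0 < a i 0).
Proof.
move=> Sx vle.
suff [t t0 tP] : exists2 t, 0 < t & forall i, i \notin tight A a x ->
    t * (A *m v) i 0 < a i 0 - (A *m x) i 0.
  exists t => // i; rewrite mulmx_ray.
  have [iT|iT] := boolP (i \in tight A a x); last first.
    have := tP i iT; rewrite ltrBrDl => lt.
    by split => // ; apply: ltW.
  split => //; have := vle i iT; move/tightP: iT => -> v0.
  by rewrite gerDl mulr_ge0_le0 // ltW.
apply: uniform_small => [i eps del eps0 led|i].
  move=> Pd iT; have slack := slack_gt0 Sx iT.
  have [v0|v0] := leP ((A *m v) i 0) 0.
    by apply: le_lt_trans (_ : 0 < _); rewrite ?subr_gt0 // mulr_ge0_le0 // ltW.
  by apply: le_lt_trans (Pd iT); rewrite ler_pM2r.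
have [iT|iT] := boolP (i \in tight A a x); first by exists 1.
have slack := slack_gt0 Sx iT.
have n0 : 0 < `|(A *m v) i 0| + 1 by rewrite ltr_wpDl.
exists ((a i 0 - (A *m x) i 0) / (`|(A *m v) i 0| + 1)) => [|_].
  by rewrite divr_gt0 // subr_gt0.
rewrite mulrAC ltr_pdivrMr // ltr_pM2l ?subr_gt0 //.
by apply: le_lt_trans (ler_norm _) _; rewrite ltrDl.
Qed.

Lemma tight_mid x y : S x -> S y ->
  S (2^-1 *: (x + y)) /\
  tight A a (2^-1 *: (x + y)) = (tight A a x :&: tight A a y)%SET.
Proof.
move=> Sx Sy.
have E := @mulmx_midE _ _ _ A x y.
split=> [i|]; first by rewrite E; move: (Sx i) (Sy i); lra.
apply/setP => i; rewrite !inE E.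
by apply/eqP/andP => [|[/eqP -> /eqP ->]]; move: (Sx i) (Sy i);
  [move=> ? ? ?; split; apply/eqP|]; lra.
Qed.

(** Take [z] with the fewest tight rows. The midpoint of [z] and [x] has the intersection of both
    tight sets, which by minimality is all of [tight A a z]. *)
Lemma min_tight F x0 :
  F `<=` S -> (forall x y, F x -> F y -> F (2^-1 *: (x + y))) -> F x0 ->
  exists2 z, F z & forall x, F x -> (tight A a z \subset tight A a x).
Proof.
move=> FS Fmid Fx0.
pose P J := `[< exists2 z, F z & tight A a z = J >].
have P0 : P (tight A a x0) by apply/asboolP; exists x0.
case: (arg_minnP (fun J : {set 'I_k} => #|J|) P0) => J /asboolP[z Fz <-] minJ.
exists z => // x Fx.
have [_ E] := tight_mid (FS _ Fz) (FS _ Fx).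
have : (#|tight A a z| <= #|tight A a z :&: tight A a x|)%N.
  by rewrite -E; apply: minJ; apply/asboolP; exists (2^-1 *: (z + x)) => //; apply: Fmid.
by move=> le; apply/finset.setIidPl/eqP; rewrite eqEcard finset.subsetIl.
Qed.

Lemma face_sub F : is_face S F -> F `<=` S.
Proof. by move=> [c [c0 [_ ->]]] x []. Qed.

(* If [F] is cut out by [c *m x = c0] then the segment from [x] to [z] can be
   prolonged beyond [x] inside [S]; as [c] is maximal at [x], it is constant on
   that segment. *)
Lemma face_upclosed F x z : is_face S F -> F x -> S z ->
  tight A a x \subset tight A a z -> F z.
Proof.
move=> [c [c0 [cmax ->]]] [Sx cx] Sz xz; split=> //=.
have [i /tightP xi|t t0 tP] := @small_step x (x - z) Sx.
  have /tightP zi : i \in tight A a z by apply: (fintype.subsetP xz); apply/tightP.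
  by rewrite mulmx_subE xi zi subrr.
have : (c *m (x + t *: (x - z))) 0 0 <= c0 by apply: cmax => i; case: (tP i).
have := cmax _ Sz; move: cx => /=.
rewrite mulmx_ray mulmx_subE => -> cz.
rewrite gerDl pmulr_rle0 // subr_le0 => zc.
by apply/eqP; rewrite eq_le cz.
Qed.

Lemma face_mid F x y : is_face S F -> F x -> F y -> F (2^-1 *: (x + y)).
Proof.
move=> [c [c0 [cmax ->]]] [Sx cx] [Sy cy]; split=> /=.
  by have [] := tight_mid Sx Sy.
by move: cx cy => /=; rewrite mulmx_midE => -> ->; lra.
Qed.

(** The sum of the inequalities in [J] is valid on [S], and it is an equality exactly where each
    summand is one. *)
Lemma face_tight J : is_face S [set x | S x /\ J \subset tight A a x].
Proof.
exists (\sum_(i in J) row i A), (\sum_(i in J) a i 0).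
have E x := sum_row_mulmx A J x.
split=> [x Sx|]; first by rewrite E; apply: ler_sum.
apply/seteqP; split=> x [Sx].
  move=> JT; split => //=; rewrite E; apply: eq_bigr => i iJ.
  by apply/tightP; apply: (fintype.subsetP JT).
move=> /=; rewrite E => /eqP; rewrite -subr_eq0 -sumrB.
rewrite -oppr_eq0 -sumrN psumr_eq0 => [/allP Eq|i _]; last first.
  by rewrite opprB subr_ge0.
split=> //; apply/fintype.subsetP => i iJ; apply/tightP/esym/eqP.
by have := Eq i (mem_index_enum i); rewrite iJ /= opprB subr_eq0.
Qed.

(** The point [z] plays the role of a relative interior point: its tight set is contained in that of
    every point of [F], and [face_upclosed] gives the converse inclusion. *)
Lemma face_tightE F : is_face S F -> F !=set0 ->
  exists2 z, F z & F = [set x | S x /\ tight A a z \subset tight A a x].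
Proof.
move=> faceF [x0 Fx0].
have [z Fz minz] := min_tight (face_sub faceF) (fun x y => @face_mid F x y faceF) Fx0.
exists z => //; apply/seteqP; split=> x.
  by move=> Fx; split; [exact: face_sub Fx|exact: minz].
by move=> [Sx]; apply: face_upclosed.
Qed.

End Polyhedron.

(** * Combinatorial equivalence from equal families of tight sets *)

Section TransportFaces.
Variables (R : realType) (m d1 d2 : nat).
Variables (A1 : 'M[R]_(m, d1)) (a1 : 'cV[R]_m) (A2 : 'M[R]_(m, d2)) (a2 : 'cV[R]_m).
Local Notation S1 := (polyhedron A1 a1).
Local Notation S2 := (polyhedron A2 a2).

Definition tight_transport (F : set 'cV[R]_d1) : set 'cV[R]_d2 :=
  [set w | S2 w /\ exists2 z, F z & tight A1 a1 z = tight A2 a2 w].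

Lemma tight_transport_face F :
  (forall z, S1 z -> exists2 w, S2 w & tight A1 a1 z = tight A2 a2 w) ->
  (forall w, S2 w -> exists2 z, S1 z & tight A1 a1 z = tight A2 a2 w) ->
  is_face S1 F -> is_face S2 (tight_transport F).
Proof.
move=> S12 S21 faceF.
have [->|/set0P F0] := eqVneq F set0.
  (* The empty face is cut out by the equation [0 = 1]. *)
  exists 0, 1; split=> [x _|]; first by rewrite mul0mx mxE ler01.
  apply/seteqP; split=> w; first by case=> _ [].
  by case=> _ /= /eqP; rewrite mul0mx mxE eq_sym oner_eq0.
have [z Fz FE] := face_tightE faceF F0.
suff -> : tight_transport F = [set w | S2 w /\ tight A1 a1 z \subset tight A2 a2 w].
  exact: face_tight.
apply/seteqP; split=> w [S2w].
  by case=> x + E; rewrite FE => -[_] /=; rewrite E.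
move=> sub; split=> //; have [x S1x E] := S21 w S2w.
by exists x => //; rewrite FE; split=> //; rewrite E.
Qed.

End TransportFaces.

(** Going there and back reaches exactly the points sharing a tight set with some point of [F], and
    these lie in [F] by [face_upclosed]. *)
Lemma tight_transportK (R : realType) (m d1 d2 : nat)
    (A1 : 'M[R]_(m, d1)) (a1 : 'cV[R]_m) (A2 : 'M[R]_(m, d2)) (a2 : 'cV[R]_m)
    (F : set 'cV[R]_d1) :
  (forall z, polyhedron A1 a1 z ->
     exists2 w, polyhedron A2 a2 w & tight A1 a1 z = tight A2 a2 w) ->
  is_face (polyhedron A1 a1) F ->
  tight_transport A2 a2 A1 a1 (tight_transport A1 a1 A2 a2 F) = F.
Proof.
move=> S12 faceF; apply/seteqP; split=> z.
  case=> S1z [w [S2w [x Fx xw] wz]]; apply: (face_upclosed faceF Fx S1z).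
  by rewrite xw wz.
move=> Fz; have S1z := face_sub faceF Fz; split=> //.
by have [w S2w E] := S12 z S1z; exists w => //; split => //; exists z.
Qed.

Lemma tight_combinatorially_equivalent (R : realType) (m d1 d2 : nat)
    (A1 : 'M[R]_(m, d1)) (a1 : 'cV[R]_m) (A2 : 'M[R]_(m, d2)) (a2 : 'cV[R]_m) :
  (forall z, polyhedron A1 a1 z ->
     exists2 w, polyhedron A2 a2 w & tight A1 a1 z = tight A2 a2 w) ->
  (forall w, polyhedron A2 a2 w ->
     exists2 z, polyhedron A1 a1 z & tight A1 a1 z = tight A2 a2 w) ->
  combinatorially_equivalent (polyhedron A1 a1) (polyhedron A2 a2).
Proof.
move=> S12 S21; pose f := tight_transport A1 a1 A2 a2.
pose g := tight_transport A2 a2 A1 a1.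
have S12' w : polyhedron A2 a2 w ->
    exists2 z, polyhedron A1 a1 z & tight A2 a2 w = tight A1 a1 z.
  by move=> /S21[z ? ?]; exists z.
have S21' z : polyhedron A1 a1 z ->
    exists2 w, polyhedron A2 a2 w & tight A2 a2 w = tight A1 a1 z.
  by move=> /S12[w ? ?]; exists w.
have fK F : is_face (polyhedron A1 a1) F -> g (f F) = F := tight_transportK S12.
have gK F : is_face (polyhedron A2 a2) F -> f (g F) = F := tight_transportK S12'.
exists f; split; last first.
  move=> F G fF fG; split=> [FG w [S2w [z Fz E]]|fFG].
    by split=> //; exists z => //; apply: FG.
  rewrite -(fK F fF) -(fK G fG) => z [S1z [w fFw E]].
  by split=> //; exists w => //; apply: fFG.
split=> [F fF|F G /set_mem fF /set_mem fG E|G fG].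
- exact: tight_transport_face.
- by rewrite -(fK F fF) -(fK G fG) E.
- by exists (g G); [exact: tight_transport_face|exact: gK].
Qed.

(** * Rank of the tight rows and dimension of faces *)

Lemma dim_fullcV (F : fieldType) d : \dim (fullv : {vspace 'cV[F]_d}) = d.
Proof. by rewrite dimvf dim_matrix -[RHS]muln1. Qed.

Section TightRank.
Variables (R : realType) (k d : nat) (A : 'M[R]_(k, d)) (a : 'cV[R]_k).
Implicit Types (x y v : 'cV[R]_d) (i : 'I_k) (J : {set 'I_k}).
Local Notation S := (polyhedron A a).

Definition rows_lfun J : 'Hom('cV[R]_d, 'cV[R]_#|J|) :=
  linfun (mulmx (rowsub (@enum_val _ (mem J)) A)).

Lemma rows_lfunE J v j : rows_lfun J v j 0 = (A *m v) (enum_val j) 0.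
Proof. by rewrite lfunE /= mul_rowsub_mx mxE. Qed.

Lemma mem_ker_rows J v :
  reflect (forall i, i \in J -> (A *m v) i 0 = 0) (v \in lker (rows_lfun J)).
Proof.
rewrite memv_ker; apply: (iffP eqP) => [Jv i iJ|Jv].
  by rewrite -(enum_rankK_in iJ iJ) -rows_lfunE Jv [LHS]mxE.
apply/matrixP => j l; rewrite (ord1 l) rows_lfunE [RHS]mxE.
by apply: Jv; apply: enum_valP.
Qed.

Lemma dim_ker_rows J : (\dim (lker (rows_lfun J)) + \dim (limg (rows_lfun J)))%N = d.
Proof.
have := limg_ker_dim (rows_lfun J) fullv.
by rewrite capfv dim_fullcV.
Qed.

Lemma dim_limg_rows J : (\dim (limg (rows_lfun J)) <= #|J|)%N.
Proof.
have := dimvS (subvf (limg (rows_lfun J))).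
by rewrite dim_fullcV.
Qed.

(** By rank-nullity the hypothesis says that the rows in [J] have rank [#|J|], that is, are linearly
    independent. *)
Lemma rows_surjective J : (#|J| + \dim (lker (rows_lfun J)) <= d)%N ->
  forall w : 'I_k -> R, exists v : 'cV[R]_d, forall i, i \in J -> (A *m v) i 0 = w i.
Proof.
move=> leJ w; have le : (#|J| <= \dim (limg (rows_lfun J)))%N.
  rewrite -(leq_add2r (\dim (lker (rows_lfun J)))) [leqRHS]addnC.
  by rewrite dim_ker_rows.
have /eqP E : limg (rows_lfun J) == fullv.
  by rewrite eqEdim subvf dim_fullcV le.
have : (\col_j w (enum_val j)) \in limg (rows_lfun J) by rewrite E memvf.
case/memv_imgP => v _ vE; exists v => i iJ.
by rewrite -(enum_rankK_in iJ iJ) -rows_lfunE -vE [LHS]mxE.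
Qed.

(** From [z] a short step in any direction of the kernel stays in the face, so the kernel is the
    direction space of its affine hull. *)
Lemma tight_face_dim z : S z ->
  has_dim [set x | S x /\ tight A a z \subset tight A a x]
    (\dim (lker (rows_lfun (tight A a z)))).
Proof.
move=> Sz; exists z, (lker (rows_lfun (tight A a z))); split => //.
  move=> x [Sx zx]; apply/mem_ker_rows => i iz.
  have /tightP xi := fintype.subsetP zx i iz; move/tightP: iz => zi.
  by rewrite mulmx_subE zi xi subrr.
move=> x1 W sub x /mem_ker_rows xz.
have [i iz|t t0 tP] := @small_step _ _ _ A a z (x - z) Sz; first by rewrite xz.
have W1 : z + t *: (x - z) - x1 \in W.
  apply: sub; split=> [i|]; first by case: (tP i).
  apply/fintype.subsetP => i iz; apply/tightP.
  by rewrite mulmx_ray xz // mulr0 addr0; apply/tightP.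
have W0 : z - x1 \in W by apply: sub.
(* This vector equals [x - x1]: dividing by [t] stretches the short step back to [x - z]. *)
have : t^-1 *: (z + t *: (x - z) - x1 - (z - x1)) + (z - x1) \in W.
  by rewrite memvD // memvZ // memvB.
rewrite /affine_subspace /=; suff -> : z + t *: (x - z) - x1 - (z - x1) = t *: (x - z).
  by rewrite scalerA mulVf ?gt_eqF // scale1r addrA subrK.
by rewrite opprB addrA subrK addrAC subrr add0r.
Qed.

(** * Facets of a full-dimensional irredundant system *)

Section Irredundant.
Hypotheses (irr : irredundant A a) (dimS : has_dim S d).

Lemma irredundant_violation i :
  exists2 p : 'cV[R]_d, (forall j, j != i -> (A *m p) j 0 <= a j 0) &
    a i 0 < (A *m p) i 0.
Proof.
apply: contrapT => no; apply: (irr (i := i)).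
have rowE x l : (row' i A *m x) l 0 = (A *m x) (lift i l) 0.
  by rewrite !mxE; apply: eq_bigr => j _; rewrite mxE.
apply/seteqP; split=> x Sx; last by move=> l; rewrite rowE [leRHS]mxE; apply: Sx.
have Sx' j : j != i -> (A *m x) j 0 <= a j 0.
  rewrite eq_sym => /unlift_some[l -> _].
  by have := Sx l; rewrite rowE [leRHS]mxE.
move=> j; have [->|/Sx' //] := eqVneq j i.
by rewrite leNgt; apply/negP => lt; apply: no; exists x.
Qed.

Lemma irredundant_row_neq0 i : exists v : 'cV[R]_d, (A *m v) i 0 != 0.
Proof.
have [x0 [_ [Sx0 _ _ _]]] := dimS.
have [p _ pi] := irredundant_violation i.
exists (p - x0); rewrite mulmx_subE subr_eq0 gt_eqF //.
by apply: le_lt_trans (Sx0 i) pi.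
Qed.

(** A row tight at a point with minimal tight set is tight on all of [S]. As the affine hull of [S]
    is the whole space, that row would vanish, which irredundancy excludes. *)
Lemma interior_point : exists2 q, S q & tight A a q = finset.set0.
Proof.
have [x0 [V [Sx0 SV Vmin dimV]]] := dimS.
have [q Sq minq] : exists2 q, S q & forall x, S x -> tight A a q \subset tight A a x.
  by apply: (@min_tight _ _ _ _ _ S x0) => // x y Sx Sy; have [] := tight_mid Sx Sy.
exists q => //; apply/setP => i; rewrite finset.in_set0; apply/negbTE/negP => iq.
have [v /eqP[]] := irredundant_row_neq0 i.
have Vfull : V = fullv.
  by apply/eqP; rewrite eqEdim subvf dim_fullcV dimV leqnn.
have sub : S `<=` affine_subspace q (lker (rows_lfun (tight A a q))).
  move=> x Sx; apply/mem_ker_rows => j jq.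
  have /tightP xj := fintype.subsetP (minq x Sx) j jq; move/tightP: jq => qj.
  by rewrite mulmx_subE qj xj subrr.
have : affine_subspace q (lker (rows_lfun (tight A a q))) (q + v).
  by apply: (Vmin _ _ sub); rewrite /affine_subspace /= Vfull memvf.
by rewrite /affine_subspace /= addrAC subrr add0r => /mem_ker_rows; apply.
Qed.

(** The segment from an interior point [q] to a point [p] violating only inequality [i] leaves [S]
    through the hyperplane of row [i] alone. *)
Lemma facet_point i : exists2 y, S y & tight A a y = [set i]%SET.
Proof.
have [q Sq q0] := interior_point; have [p pj pi] := irredundant_violation i.
have qlt j : (A *m q) j 0 < a j 0 by apply: slack_gt0 => //; rewrite q0 finset.in_set0.
set s := a i 0 - (A *m q) i 0; set r := (A *m p) i 0 - (A *m q) i 0.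
have s0 : 0 < s by rewrite subr_gt0.
have sr : s < r by rewrite ltrD2r.
have r0 : 0 < r := lt_trans s0 sr.
(* [s / r] is the parameter at which row [i] reaches [a i 0] on the segment from [q] to [p]. *)
have t0 : 0 < s / r by rewrite divr_gt0.
have t1 : s / r < 1 by rewrite ltr_pdivrMr ?mul1r.
have E j : (A *m (q + (s / r) *: (p - q))) j 0 =
    (1 - s / r) * (A *m q) j 0 + (s / r) * (A *m p) j 0.
  by rewrite mulmx_ray mulmx_subE; ring.
have Ei : (A *m (q + (s / r) *: (p - q))) i 0 = a i 0.
  by rewrite mulmx_ray mulmx_subE -/r divfK ?gt_eqF // /s addrC subrK.
have Ej j : j != i -> (A *m (q + (s / r) *: (p - q))) j 0 < a j 0.
  by move=> ji; rewrite E; have := pj j ji; have := qlt j; nra.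
exists (q + (s / r) *: (p - q)).
  by move=> j; have [->|/Ej/ltW//] := eqVneq j i; rewrite Ei.
apply/setP => j; rewrite !inE; have [->|ji] := eqVneq j i; first by rewrite Ei eqxx.
by rewrite lt_eqF // Ej.
Qed.

Definition facet_of i : set 'cV[R]_d := [set x | S x /\ [set i]%SET \subset tight A a x].

Lemma facet_ofP i : is_facet S (facet_of i).
Proof.
have [y Sy yi] := facet_point i; split; first exact: face_tight.
exists (\dim (lker (rows_lfun (tight A a y)))); split; last first.
  by rewrite /facet_of -yi; apply: tight_face_dim.
(* The only tight row at [y] is row [i], which is nonzero, so the rank is exactly one and the kernel
   has codimension one. *)
suff -> : (\dim (lker (rows_lfun (tight A a y)))).+1 = d by [].
have dimK := dim_ker_rows (tight A a y); rewrite -[RHS]dimK -addn1; congr addn.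
apply/esym/eqP; rewrite eqn_leq lt0n dimv_eq0.
rewrite (leq_trans (dim_limg_rows _)) /=; last by rewrite yi cards1.
apply/eqP => lim0; have [v /eqP[]] := irredundant_row_neq0 i.
suff /mem_ker_rows : v \in lker (rows_lfun (tight A a y)).
  by apply; rewrite yi set11.
by rewrite memv_ker -memv0 -lim0 memv_img ?memvf.
Qed.

Lemma facet_of_inj : injective facet_of.
Proof.
move=> i j E; have [y Sy yi] := facet_point i.
have [_] : facet_of j y by rewrite -E /facet_of /= yi.
by rewrite yi finset.sub1set inE => /eqP.
Qed.

(* Simplicity says that at most [d - dim F] facets contain the face [F] of [y],
   and [d - dim F] is the rank of the tight rows. *)
Lemma simple_tight_surjective y : simple_polytope S -> S y ->
  forall w : 'I_k -> R,
    exists v : 'cV[R]_d, forall i, i \in tight A a y -> (A *m v) i 0 = w i.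
Proof.
move=> [_ simp] Sy; set J := tight A a y; apply: rows_surjective.
have := simp _ _ _ (face_tight A a J) _ dimS (tight_face_dim Sy).
have F0 : [set x | S x /\ J \subset tight A a x] !=set0 by exists y; split.
move=> /(_ F0)/card_set_bijP[f [fun_f inj_f _]].
(* Each tight row yields a facet through the face, and distinct rows yield distinct facets;
   composing with [f] injects [J] into [d - m] elements. *)
have Jf i : i \in J -> [set G | is_facet S G /\
    [set x | S x /\ J \subset tight A a x] `<=` G] (facet_of i).
  move=> iJ; split; first exact: facet_ofP.
  by move=> x [Sx Jx]; split=> //; rewrite finset.sub1set (fintype.subsetP Jx).
set m := \dim _; rewrite -/m in fun_f.
have md : (m <= d)%N by rewrite -(dim_ker_rows J) leq_addr.
rewrite addnC -leq_subRL //.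
pose g (j : 'I_#|J|) : 'I_(d - m) := Ordinal (fun_f _ (Jf _ (enum_valP j))).
have g_inj : injective g.
  move=> j1 j2 [E]; apply: enum_val_inj; apply: facet_of_inj.
  apply: inj_f; rewrite ?inE //;
    exact: Jf (enum_valP _).
by have := leq_card g g_inj; rewrite !card_ord.
Qed.

End Irredundant.
End TightRank.

(** * Minima of linear functionals on bounded polyhedra *)

Lemma mulmx_row_continuous (R : realType) (k d : nat) (A : 'M[R]_(k, d)) i :
  continuous (fun r : 'rV[R]_d => (A *m r^T) i 0).
Proof.
have -> : (fun r : 'rV[R]_d => (A *m r^T) i 0) = (fun r => \sum_j A i j * r 0 j).
  by apply/funext => r; rewrite mxE; apply: eq_bigr => j _; rewrite mxE.
elim: (index_enum 'I_d) => [|j s IHs].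
  by under eq_fun do rewrite big_nil; apply: cst_continuous.
under eq_fun do rewrite big_cons.
have coordj : continuous (fun r : 'rV[R]_d => A i j * r 0 j).
  by move=> r; apply: continuousM; [exact: cst_continuous|exact: coord_continuous].
by move=> r; apply: (continuousD (coordj r) (IHs r)).
Qed.

Lemma polyhedron_min (R : realType) (k d : nat) (A : 'M[R]_(k, d))
    (a : 'cV[R]_k) (rho : R) (c : 'rV[R]_d) :
  in_box rho (polyhedron A a) -> polyhedron A a !=set0 ->
  exists2 y, polyhedron A a y &
    forall x, polyhedron A a x -> (c *m y) 0 0 <= (c *m x) 0 0.
Proof.
move=> box [x0 Sx0]; pose K : set 'rV[R]_d := [set r | polyhedron A a r^T].
have closedK : closed K.
  have -> : K = \bigcap_i [set r | (A *m r^T) i 0 <= a i 0].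
    by apply/seteqP; split=> r Kr => [i _|i]; apply: Kr.
  apply: closed_bigI => i _.
  apply: (@preimage_closed _ _ (fun r : 'rV[R]_d => (A *m r^T) i 0)
            [set t | t <= a i 0]); last exact: closed_le.
  by move=> r _; apply: mulmx_row_continuous.
have compactK : compact K.
  have compact_box : compact [set r : 'rV[R]_d | forall i, `[- rho, rho]%classic (r 0 i)].
    by apply: (@rV_compact R d (fun=> `[- rho, rho]%classic)) => _;
      apply: segment_compact.
  apply: subclosed_compact closedK compact_box _ => r Kr i.
  by have := box _ Kr i; rewrite mxE ler_norml /= in_itv.
have K0 : K !=set0 by exists x0^T; rewrite /K /= trmxK.
have [r /set_mem Kr rmin] := compact_EVT_min K0 compactK
  (continuous_subspaceT (@mulmx_row_continuous _ _ _ c 0)).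
exists r^T => // x Sx; have := rmin x^T; rewrite trmxK; apply.
by rewrite inE /K /= trmxK.
Qed.

(** * Tight sets under perturbation of the right-hand side *)

Section Perturbation.
Variables (R : realType) (n e : nat) (B : 'M[R]_(n, e)) (b : 'cV[R]_n).
Implicit Types (y v : 'cV[R]_e) (u : 'cV[R]_n) (J : {set 'I_n}).
Local Notation Q := (polyhedron B b).

(** Surjectivity gives vectors [v j] dual to the tight rows. Moving [y] by the combination with
    coefficients [u j 0] shifts each tight row by exactly its perturbation. *)
Lemma tight_perturb_up y :
  Q y ->
  (forall w : 'I_n -> R,
     exists v, forall i, i \in tight B b y -> (B *m v) i 0 = w i) ->
  exists2 del, 0 < del & forall u, (forall i, `|u i 0| <= del) ->
    exists2 y', polyhedron B (b + u) y' & tight B (b + u) y' = tight B b y.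
Proof.
move=> Qy surj.
have {surj} /choice[v vE] : forall j : 'I_n, exists v, forall i, i \in tight B b y ->
    (B *m v) i 0 = (i == j)%:R by move=> j; apply: surj.
pose D i : R := \sum_j `|(B *m v j) i 0|.
have D0 i : 0 <= D i by apply: sumr_ge0.
(* The slack of a non-tight row must absorb a growth of at most [del * D i] on the left and a drop
   of at most [del] on the right. *)
suff [del del0 delP] : exists2 del, 0 < del & forall i, i \notin tight B b y ->
    del * (D i + 1) < b i 0 - (B *m y) i 0.
  exists del => // u udel; pose y' := y + \sum_j u j 0 *: v j.
  have By' i : (B *m y') i 0 = (B *m y) i 0 + \sum_j u j 0 * (B *m v j) i 0.
    rewrite mulmxDr mulmx_sumr [LHS]mxE summxE; congr (_ + _).
    by apply: eq_bigr => j _; rewrite -scalemxAr [LHS]mxE.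
  have eqT i : i \in tight B b y -> (B *m y') i 0 = (b + u) i 0.
    move=> iT; rewrite By' (tightP _ _ _ _ iT) [RHS]mxE; congr (_ + _).
    rewrite (bigD1 i) //= vE // eqxx mulr1 big1 ?addr0 // => j ji.
    by rewrite vE // eq_sym (negbTE ji) mulr0.
  have ltT i : i \notin tight B b y -> (B *m y') i 0 < (b + u) i 0.
    move=> iT; rewrite By' [ltRHS]mxE.
    have le1 : \sum_j u j 0 * (B *m v j) i 0 <= del * D i.
      rewrite mulr_sumr; apply: ler_sum => j _.
      by apply: le_trans (ler_norm _) _; rewrite normrM ler_wpM2r.
    have := delP i iT; have := udel i; rewrite ler_norml; lra.
  exists y' => [i|].
    by have [/eqT->|/ltT/ltW] := boolP (i \in tight B b y).
  apply/setP => i; have [iT|iT] := boolP (i \in tight B b y).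
    by apply/tightP/eqT.
  by rewrite inE lt_eqF // ltT.
apply: uniform_small => [i eps del eps0 led Pd iT|i].
  by apply: le_lt_trans (Pd iT); rewrite ler_wpM2r // addr_ge0.
have [iT|iT] := boolP (i \in tight B b y); first by exists 1.
have slack := slack_gt0 Qy iT.
have D1 : 0 < D i + 1 by rewrite ltr_wpDl.
exists ((b i 0 - (B *m y) i 0) / (D i + 1) / 2) => [|_].
  by rewrite !divr_gt0 // subr_gt0.
rewrite mulrAC divfK ?gt_eqF // ltr_pdivrMr //; lra.
Qed.

(** If the total slack [g] of [J] has a positive minimum on [Q], pulling [y'] slightly towards the
    interior point [q] lands in [Q] with a smaller total slack, a contradiction. *)
Lemma tight_perturb_down q rho J :
  Q q -> tight B b q = finset.set0 -> in_box rho Q ->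
  exists2 del, 0 < del & forall u y', (forall i, `|u i 0| <= del) ->
    polyhedron B (b + u) y' -> J \subset tight B (b + u) y' ->
    exists2 y, Q y & J \subset tight B b y.
Proof.
move=> Qq q0 box; pose g y := \sum_(i in J) (b i 0 - (B *m y) i 0).
have g_ge0 y : Q y -> 0 <= g y by move=> Qy; apply: sumr_ge0 => i _; rewrite subr_ge0.
have [y0 Qy0 y0min] : exists2 y, Q y & forall x, Q x -> g y <= g x.
  have [|y Qy ymin] := polyhedron_min (- \sum_(i in J) row i B) box; first by exists q.
  exists y => // x Qx; rewrite /g !sumrB lerD2l.
  by have := ymin x Qx; rewrite !mulNmx [leLHS]mxE [leRHS]mxE !sum_row_mulmx.
have [gy0|gy0] := leP (g y0) 0.
  exists 1 => // _ _ _ _ _; exists y0 => //.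
  apply/fintype.subsetP => i iJ; apply/tightP/eqP.
  have : g y0 == 0 by rewrite eq_le gy0 g_ge0.
  rewrite psumr_eq0 => [/allP/(_ i (mem_index_enum i))|j _]; last by rewrite subr_ge0.
  by rewrite iJ /= subr_eq0 eq_sym.
have [s s0 sP] : exists2 s, 0 < s & forall i, (B *m q) i 0 <= b i 0 - s.
  apply: uniform_small => [i eps del _ led|i]; first by lra.
  have slack : (B *m q) i 0 < b i 0 by apply: slack_gt0; rewrite ?q0 ?finset.in_set0.
  by exists (b i 0 - (B *m q) i 0); lra.
have N0 : 0 <= (#|J|%:R : R) by [].
have gq := g_ge0 q Qq.
(* The pulled point will have total slack at most [del * K]; the choice [del = g y0 / (K + 1)] puts
   this below the minimum [g y0]. *)
pose K := #|J|%:R + g q / s.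
have K0 : 0 <= K by rewrite addr_ge0 // divr_ge0 // ltW.
exists (g y0 / (K + 1)) => [|u y' udel Py' JT]; first by rewrite divr_gt0 // ltr_wpDl.
set del := g y0 / (K + 1) in udel.
have del0 : 0 < del by rewrite divr_gt0 // ltr_wpDl.
have delK : del * (K + 1) = g y0 by rewrite divfK // gt_eqF // ltr_wpDl.
exfalso.
(* This [t] solves [(1 - t) * del = t * s]: the slack [s] of [q] exactly offsets the excess [del] of
   [y']. *)
set t := del / (del + s).
have ds0 : 0 < del + s by rewrite addr_gt0.
have t0 : 0 < t by rewrite divr_gt0.
have tE : t * (del + s) = del by rewrite divfK // gt_eqF.
have t1 : t < 1 by rewrite ltr_pdivrMr // mul1r ltrDl.
have ts : t <= del / s by rewrite ler_pdivlMr // -tE; nra.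
pose z := y' + t *: (q - y').
have zE i : (B *m z) i 0 = (1 - t) * (B *m y') i 0 + t * (B *m q) i 0.
  by rewrite mulmx_ray mulmx_subE; ring.
have Qz : Q z.
  move=> i; rewrite zE; have := Py' i; rewrite [leRHS]mxE.
  have := udel i; rewrite ler_norml => /andP[_ ui] Pi; have := sP i; nra.
have : g z <= del * K.
  apply: (@le_trans _ _ (\sum_(i in J) (del + t * (b i 0 - (B *m q) i 0)))).
    apply: ler_sum => i iJ; rewrite zE.
    have /tightP -> := fintype.subsetP JT i iJ; rewrite mxE.
    have := udel i; rewrite ler_norml => /andP[ui _]; nra.
  rewrite big_split /= sumr_const -mulr_sumr -/(g q) /K mulrDr mulr_natr lerD2l.
  by rewrite [leRHS]mulrA [leRHS]mulrAC ler_wpM2r.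
have := y0min z Qz; nra.
Qed.

(** A direction that is constant on the rows of [J] and strictly decreasing on the other tight rows
    releases precisely the latter. *)
Lemma tight_subset_realize y J :
  Q y -> J \subset tight B b y ->
  (forall w : 'I_n -> R,
     exists v, forall i, i \in tight B b y -> (B *m v) i 0 = w i) ->
  exists2 z, Q z & tight B b z = J.
Proof.
move=> Qy JT surj; have [v vE] := surj (fun i => - (i \notin J)%:R).
have [i iT|t t0 tP] := @small_step _ _ _ B b y v Qy.
  by rewrite vE // oppr_le0.
exists (y + t *: v) => [i|]; first by case: (tP i).
apply/setP => i; rewrite inE.
have [iT|iT] := boolP (i \in tight B b y).
  rewrite mulmx_ray vE // (tightP _ _ _ _ iT).
  case: (i \in J); first by rewrite oppr0 mulr0 addr0 eqxx.
  by rewrite mulrN1 lt_eqF // ltrBlDr ltrDl.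
have [_ /(_ iT) lt] := tP i; rewrite lt_eqF //.
by apply/esym/negbTE; apply: contra iT; apply: fintype.subsetP.
Qed.

End Perturbation.

(** There are finitely many [J], so one threshold for each suffices. Simplicity and irredundancy
    supply the surjectivity at every point of [Q]. *)
Lemma tight_stable (R : realType) (n e : nat) (B : 'M[R]_(n, e)) (b : 'cV[R]_n) :
  has_dim (polyhedron B b) e -> simple_polytope (polyhedron B b) ->
  irredundant B b ->
  exists2 del, 0 < del & forall u : 'cV[R]_n, (forall i, `|u i 0| <= del) ->
    forall J : {set 'I_n},
      (exists2 y, polyhedron B b y & tight B b y = J) <->
      (exists2 y, polyhedron B (b + u) y & tight B (b + u) y = J).
Proof.
move=> dimQ simQ irr; have [[_ [rho box]] _] := simQ.
have surj y Qy := simple_tight_surjective irr dimQ (y := y) simQ Qy.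
have [q Qq q0] := interior_point irr dimQ.
suff [del del0 delP] : exists2 del, 0 < del & forall (J : {set 'I_n}) (u : 'cV[R]_n),
    (forall i, `|u i 0| <= del) ->
      (exists2 y, polyhedron B b y & tight B b y = J) <->
      (exists2 y, polyhedron B (b + u) y & tight B (b + u) y = J).
  by exists del => // u ud J; apply: delP.
apply: uniform_small => [J eps del _ led Pd u ueps|J].
  by apply: Pd => i; apply: le_trans led.
have [d1 d10 down] := tight_perturb_down J Qq q0 box.
have downJ (u : 'cV[R]_n) : (forall i, `|u i 0| <= d1) ->
    (exists2 y, polyhedron B (b + u) y & tight B (b + u) y = J) ->
    exists2 y, polyhedron B b y & tight B b y = J.
  move=> ud [y' Py' yJ]; have [|y Qy Jy] := down u y' ud Py'; first by rewrite yJ.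
  exact: tight_subset_realize Qy Jy (surj y Qy).
have [[y Qy yJ]|noJ] := pselect (exists2 y, polyhedron B b y & tight B b y = J).
  have [d2 d20 up] := tight_perturb_up Qy (surj y Qy).
  exists (Num.min d1 d2) => [|u umin]; first by rewrite lt_min d10 d20.
  split=> [_|]; last first.
    by apply: downJ => i; apply: le_trans (umin i) _; rewrite ge_min lexx.
  have [i|y' ? ?] := up u; last by exists y'; rewrite // -yJ.
  by apply: le_trans (umin i) _; rewrite ge_min lexx orbT.
by exists d1 => // u ud; split=> [/noJ|/(downJ u ud)].
Qed.

(** * Both products as block systems, and rescaling *)

Lemma cV_subE (V : zmodType) (n : nat) (x y : 'cV[V]_n) i :
  (x - y) i 0 = x i 0 - y i 0.
Proof. by rewrite mxE [X in _ + X]mxE. Qed.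

Lemma cV_scaleE (R : pzRingType) (n : nat) (c : R) (x : 'cV[R]_n) i :
  (c *: x) i 0 = c * x i 0.
Proof. by rewrite mxE. Qed.

Section BlockPolyhedron.
Variables (R : realType) (k n d e : nat).
Variables (A : 'M[R]_(k, d)) (a : 'cV[R]_k) (B : 'M[R]_(n, e)).
Implicit Types (C : 'M[R]_(n, d)) (b : 'cV[R]_n) (z : 'cV[R]_(d + e)).
Local Notation block C := (block_mx A 0 C B).

Lemma block_mulmxu C z i :
  (block C *m z) (lshift n i) 0 = (A *m usubmx z) i 0.
Proof. by rewrite -{1}(vsubmxK z) mul_block_col mul0mx addr0 col_mxEu. Qed.

Lemma block_mulmxd C z i :
  (block C *m z) (rshift k i) 0 = (C *m usubmx z) i 0 + (B *m dsubmx z) i 0.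
Proof. by rewrite -{1}(vsubmxK z) mul_block_col col_mxEd [LHS]mxE. Qed.

(** Separates the base point [x] in [P] from its fibre, a copy of the system [B] with right-hand
    side shifted by [C *m x]. *)
Lemma polyhedron_block C b z :
  polyhedron (block C) (col_mx a b) z <->
  polyhedron A a (usubmx z) /\ polyhedron B (b - C *m usubmx z) (dsubmx z).
Proof.
split=> [Sz|[Pz Qz] i].
  split=> i; first by have := Sz (lshift n i); rewrite block_mulmxu col_mxEu.
  have := Sz (rshift k i); rewrite block_mulmxd col_mxEd.
  by rewrite cV_subE lerBrDl.
case: (split_ordP i) => j ->; first by rewrite block_mulmxu col_mxEu.
by have := Qz j; rewrite block_mulmxd col_mxEd cV_subE lerBrDl.
Qed.

Lemma tight_block C1 C2 b1 b2 z1 z2 :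
  tight A a (usubmx z1) = tight A a (usubmx z2) ->
  tight B (b1 - C1 *m usubmx z1) (dsubmx z1) =
    tight B (b2 - C2 *m usubmx z2) (dsubmx z2) ->
  tight (block C1) (col_mx a b1) z1 = tight (block C2) (col_mx a b2) z2.
Proof.
move=> /setP TA /setP TB; apply/setP => i; rewrite !inE.
case: (split_ordP i) => j ->.
  by have := TA j; rewrite !inE !block_mulmxu !col_mxEu.
have E C b z : ((block C *m z) (rshift k j) 0 == col_mx a b (rshift k j) 0) =
    (j \in tight B (b - C *m usubmx z) (dsubmx z)).
  rewrite inE block_mulmxd col_mxEd cV_subE.
  by rewrite addrC eq_sym -subr_eq eq_sym.
by rewrite !E TB.
Qed.

Lemma deformed_productE b C M :
  deformed_product A a B b C M = polyhedron (block C) (col_mx a (M *: b)).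
Proof.
apply/seteqP; split=> z; last first.
  move=> /polyhedron_block[Pz Qz]; split=> // i; have := Qz i.
  by rewrite cV_subE lerBrDl => le; rewrite [leLHS]mxE.
case=> Pz Qz; apply/polyhedron_block; split=> // i; have := Qz i.
by rewrite [leLHS]mxE cV_subE lerBrDl.
Qed.

Lemma cartesianE b :
  cartesian (polyhedron A a) (polyhedron B b) = polyhedron (block 0) (col_mx a b).
Proof.
by apply/seteqP; split=> z; [move=> [? ?]; apply/polyhedron_block|
  move=> /polyhedron_block]; rewrite mul0mx subr0.
Qed.

Lemma polyhedron_scale M b y : 0 < M ->
  polyhedron B (M *: b) (M *: y) <-> polyhedron B b y.
Proof.
move=> M0; split=> Qy i; have := Qy i.
  by rewrite -scalemxAr !cV_scaleE ler_pM2l.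
by rewrite -scalemxAr !cV_scaleE ler_pM2l.
Qed.

Lemma tight_scale M b y : 0 < M -> tight B (M *: b) (M *: y) = tight B b y.
Proof.
move=> M0; apply/setP => i; rewrite !inE -scalemxAr !cV_scaleE.
by rewrite (inj_eq (mulfI (lt0r_neq0 M0))).
Qed.

End BlockPolyhedron.

(* The bound M0 depends on B, b, C and, for P, only on the size [rho] of a box
   containing P: some dependence on the size of P cannot be avoided. *)
Theorem proposition2p10 (R : realType) (d e n : nat)
    (B : 'M[R]_(n, e)) (b : 'cV[R]_n) (C : 'M[R]_(n, d))
    (Q_polytope : polytope_of_dim e (polyhedron B b))
    (Q_simple : simple_polytope (polyhedron B b))
    (Q_irredundant : irredundant B b)
    (rho : R) :
  exists M0 : R,
    forall (k : nat) (A : 'M[R]_(k, d)) (a : 'cV[R]_k),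
      polytope_of_dim d (polyhedron A a) ->
      irredundant A a ->
      in_box rho (polyhedron A a) ->
      forall M : R, 0 < M -> M0 <= M ->
        combinatorially_equivalent
          (deformed_product A a B b C M)
          (cartesian (polyhedron A a) (polyhedron B b)).
Proof.
have [_ dimQ] := Q_polytope.
have [del del0 stable] := tight_stable dimQ Q_simple Q_irredundant.
(* [K] bounds every entry of [C *m x] for [x] in the box, so [M >= K / del] keeps the perturbation
   [u x] within [del]. *)
pose K := \sum_i \sum_j `|C i j| * `|rho|.
exists (K / del) => k A a _ _ box M M0; rewrite ler_pdivrMr // => KM.
pose u (x : 'cV[R]_d) := - (M^-1 *: (C *m x)).
have u_small x : polyhedron A a x -> forall i, `|u x i 0| <= del.
  move=> Px i; rewrite mxE normrN cV_scaleE normrM gtr0_norm ?invr_gt0 //.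
  rewrite mulrC ler_pdivrMr // mulrC; apply: le_trans KM.
  apply: (@le_trans _ _ (\sum_j `|C i j| * `|rho|)).
    rewrite mxE; apply: le_trans (ler_norm_sum _ _ _) _.
    apply: ler_sum => j _; rewrite normrM ler_wpM2l //.
    by apply: le_trans (box x Px j) (ler_norm _).
  rewrite /K (bigD1 i) //= lerDl; apply: sumr_ge0 => i' _.
  by apply: sumr_ge0 => j _; rewrite mulr_ge0.
have scaleE x : M *: b - C *m x = M *: (b + u x).
  by rewrite /u scalerDr scalerN scalerA divff ?gt_eqF // scale1r.
rewrite deformed_productE cartesianE; apply: tight_combinatorially_equivalent => z.
  move=> /polyhedron_block; set x := usubmx z; rewrite scaleE => -[Px].
  (* Rescaling the fibre by [M^-1] gives a point of the perturbed [Q]; stability replaces it by a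
     point of [Q] with the same tight set, over the same [x]. *)
  have dzE : dsubmx z = M *: (M^-1 *: dsubmx z).
    by rewrite scalerA divff ?gt_eqF // scale1r.
  move: dzE; set y := M^-1 *: _ => dzE; rewrite dzE => /(polyhedron_scale _ _ _ M0) Qy.
  have [_ []] := stable (u x) (u_small x Px) (tight B (b + u x) y).
    by exists y.
  move=> y2 Qy2 T; exists (col_mx x y2).
    by apply/polyhedron_block; rewrite col_mxKu col_mxKd mul0mx subr0.
  apply: tight_block; rewrite col_mxKu // col_mxKd mul0mx subr0 T -/x scaleE dzE.
  exact: tight_scale.
move=> /polyhedron_block; set x := usubmx z; rewrite mul0mx subr0 => -[Px Qy].
(* Conversely, a point of [Q] is replaced by one of the perturbed [Q] with the same tight set, then
   scaled up by [M]. *)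
have [[]] := stable (u x) (u_small x Px) (tight B b (dsubmx z)).
  by exists (dsubmx z).
move=> y Qy2 T _; exists (col_mx x (M *: y)).
  apply/polyhedron_block; rewrite col_mxKu col_mxKd scaleE; split=> //.
  exact/polyhedron_scale.
apply: tight_block; rewrite col_mxKu // col_mxKd scaleE mul0mx subr0 -T.
exact: tight_scale.
Qed.
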